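(* Let $\mathcal{C}$ be a clutter with a perfect matching $e_1,\ldots,e_g$ of König type. If all c-minors of $\mathcal{C}$ have a free vertex and $\mathcal{C}$ is unmixed, then $\Delta_{\mathcal{C}}$ is pure shellable.
   Context: A clutter $\mathcal{C}$ with finite vertex set $X=\{x_1,\ldots,x_n\}$ is a family $E(\mathcal{C})$ of subsets of $X$, called edges, none of which is included in another. Let $R=K[x_1,\ldots,x_n]$ be a polynomial ring over a field $K$. The edge ideal of $\mathcal{C}$ is the ideal $I(\mathcal{C})\subset R$ generated by the monomials $\prod_{x_i\in e}x_i$, $e\in E(\mathcal{C})$; this gives a one-to-one correspondence between clutters and square-free monomial ideals. A vertex cover of $\mathcal{C}$ is a subset of $X$ meeting every edge; it is minimal if no proper subset is a vertex cover. The height of $I(\mathcal{C})$ equals the minimum size of a vertex cover. $\mathcal{C}$ is unmixed if all its minimal vertex covers have the same size. A perfect matching of König type of $\mathcal{C}$ is a collection $e_1,\ldots,e_g$ of pairwise disjoint edges whose union is $X$ and such that $g$ is the height of $I(\mathcal{C})$. c-minors: for a square-free monomial ideal $L$ and a variable $x$, the ideal $(L\colon x)=\{f : fx\in L\}$ is called a contraction of $L$ ($L$ itself is also regarded as a contraction of $L$). A c-minor of $I=I(\mathcal{C})$ is an ideal obtained from $I$ by a sequence of contractions; moreover, if a c-minor $I'$ contains a variable $x_i$ and we remove this variable from the generators of $I'$, the new ideal is still considered a c-minor of $I$. A c-minor of $\mathcal{C}$ is a clutter corresponding to a c-minor of $I$. A free vertex of a clutter is a vertex that occurs in exactly one edge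 (equivalently, a variable that appears in exactly one of the minimal monomial generators of the edge ideal). The condition ``all c-minors have a free vertex'' refers to those c-minors whose ideal is neither zero nor the whole ring. $\Delta_{\mathcal{C}}$ is the simplicial complex on $X$ whose faces are the subsets of $X$ containing no edge of $\mathcal{C}$. A simplicial complex $\Delta$ is shellable if its facets can be ordered $F_1,\ldots,F_s$ such that for all $1\leq i<j\leq s$ there exist $v\in F_j\setminus F_i$ and $\ell\in\{1,\ldots,j-1\}$ with $F_j\setminus F_\ell=\{v\}$. It is pure if all its facets have the same dimension, and pure shellable if it is both pure and shellable. *)

(* Defs.v *)
From mathcomp Require Import all_boot all_order all_algebra.
From mathcomp Require Import boolp classical_sets.
From mathcomp Require Import mpoly.

Set Implicit Arguments.
Unset Strict Implicit.
Unset Printing Implicit Defensive.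

Import GRing.Theory.
Local Open Scope ring_scope.

Definition ideal (R : comNzRingType) (I : set R) : Prop :=
  [/\ I 0, forall a b, I a -> I b -> I (a + b) & forall a b, I b -> I (a * b)].

Definition ideal_gen (R : comNzRingType) (G : set R) : set R :=
  smallest (@ideal R) G.

(* The library's [idealr_closed] already includes properness. *)
Definition prime_ideal (R : comNzRingType) (P : set R) : Prop :=
  idealr_closed (mem P) /\ prime_idealr_closed (mem P).

Definition prime_chain (R : comNzRingType) (P : set R) (h : nat)
    (c : nat -> set R) : Prop :=
  [/\ forall k, (k <= h)%N -> prime_ideal (c k),
      forall k, (k < h)%N -> (c k `<` c k.+1)%classic
    & c h = P].

Definition prime_height (R : comNzRingType) (P : set R) (h : nat) : Prop :=
  (exists c, prime_chain P h c) /\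
  (forall k c, prime_chain P k c -> (k <= h)%N).

(* Krull height as a relation with natural values: primes of infinite height
   do not contribute to the minimum, and the whole ring has no height. *)
Definition height (R : comNzRingType) (I : set R) (h : nat) : Prop :=
  (exists P, [/\ prime_ideal P, (I `<=` P)%classic & prime_height P h]) /\
  (forall P k, prime_ideal P -> (I `<=` P)%classic -> prime_height P k ->
     (h <= k)%N).

Definition clutter (T : finType) (C : {set {set T}}) : Prop :=
  {in C &, forall e f : {set T}, e \subset f -> e = f}.

Definition vertex_cover (T : finType) (C : {set {set T}}) (A : {set T}) : bool :=
  [forall e in C, e :&: A != finset.set0].

Definition unmixed (T : finType) (C : {set {set T}}) : Prop :=
  forall A B, minset (vertex_cover C) A -> minset (vertex_cover C) B ->
  #|A| = #|B|.

Definition free_vertex (T : finType) (C : {set {set T}}) (v : T) : Prop :=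
  #|[set e in C | v \in e]%SET| = 1%N.

Definition edge_ideal (K : fieldType) (n : nat) (C : {set {set 'I_n}}) :
    set {mpoly K[n]} :=
  ideal_gen [set p | exists2 e, e \in C & p = \prod_(i in e) 'X_i]%classic.
Arguments edge_ideal K {n} C _.

Definition konig_perfect_matching (K : fieldType) (n : nat)
    (C : {set {set 'I_n}}) (g : nat) (e : 'I_g -> {set 'I_n}) : Prop :=
  [/\ forall i, e i \in C,
      forall i j, i != j -> [disjoint e i & e j],
      (\bigcup_i e i)%SET = finset.setT
    & height (edge_ideal K C) g].
Arguments konig_perfect_matching K {n} C {g} e.

Definition colon (R : comNzRingType) (I : set R) (x : R) : set R :=
  [set f | I (f * x)]%classic.

Definition min_monomial (K : fieldType) (n : nat) (I : set {mpoly K[n]})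
    (m : 'X_{1..n}) : Prop :=
  I 'X_[m] /\ (forall m', (m' <= m)%MM -> I 'X_[m'] -> m' = m).

Definition remove_variable (K : fieldType) (n : nat) (I : set {mpoly K[n]})
    (i : 'I_n) : set {mpoly K[n]} :=
  ideal_gen [set p | exists m,
    [/\ min_monomial I m, m != U_(i)%MM & p = 'X_[m]]]%classic.

Inductive ideal_cminor (K : fieldType) (n : nat) (I : set {mpoly K[n]}) :
    set {mpoly K[n]} -> Prop :=
| cminor_refl : ideal_cminor I I
| cminor_colon J i : ideal_cminor I J -> ideal_cminor I (colon J 'X_i)
| cminor_remove J i : ideal_cminor I J -> J 'X_i ->
    ideal_cminor I (remove_variable J i).

Definition clutter_cminor (K : fieldType) (n : nat)
    (C D : {set {set 'I_n}}) : Prop :=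
  clutter D /\ ideal_cminor (edge_ideal K C) (edge_ideal K D).
Arguments clutter_cminor K {n} C D.

Definition cminors_have_free_vertex (K : fieldType) (n : nat)
    (C : {set {set 'I_n}}) : Prop :=
  forall D, clutter_cminor K C D ->
    edge_ideal K D <> [set 0]%classic ->
    edge_ideal K D <> [set: {mpoly K[n]}]%classic ->
  exists v, free_vertex D v.
Arguments cminors_have_free_vertex K {n} C.

Definition independence_complex (T : finType) (C : {set {set T}}) :
    {set {set T}} :=
  [set F : {set T} | [forall e in C, ~~ (e \subset F)]]%SET.

Definition facets (T : finType) (Delta : {set {set T}}) : {set {set T}} :=
  [set F | maxset (fun G => G \in Delta) F]%SET.

(* The dimension of a face F is #|F| - 1. *)
Definition pure (T : finType) (Delta : {set {set T}}) : Prop :=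
  {in facets Delta &, forall F G : {set T}, #|F| = #|G|}.

Definition shellable (T : finType) (Delta : {set {set T}}) : Prop :=
  exists s : seq {set T},
  [/\ uniq s, s =i facets Delta
    & forall i j, (i < j < size s)%N ->
      exists v l,
        [/\ v \in nth finset.set0 s j :\: nth finset.set0 s i, (l < j)%N
          & nth finset.set0 s j :\: nth finset.set0 s l = finset.set1 v]].

(* Main.v *)
Require Import Defs.
From mathcomp Require Import all_boot all_order all_algebra.
From mathcomp Require Import boolp classical_sets.
From mathcomp Require Import mpoly.
(* Imported last, so that set0, subsetP and similar names mean finite sets. *)
From mathcomp Require Import fintype finset.

(** Facets of the independence complex are the complements of the minimal vertex
    covers, so purity is unmixedness, and a shelling is an ordering of the
    minimal covers in which, whenever [A] precedes [B], some vertex [v] of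
    [A :\: B] is the whole of [A' :\: B] for a cover [A'] preceding [B].  Such
    an ordering is built by induction on the number of vertices lying on edges
    ([cover_shellable]).

    Let [v] be a free vertex, lying on the single minimal edge [f].
    - The minimal covers that avoid [v] are those of the contraction at [v].
    - A minimal cover that contains [v] has no other vertex in [f], because [v]
      is there only to meet [f] ([free_vertex_cover]).  Hence these covers are
      the sets [v |: A], where [A] is a minimal cover of the c-minor obtained by
      contracting [f :\ v], which turns [f] into the edge [[set v]], and then
      removing the variable [v].
    Both c-minors are unmixed and have fewer vertices, hence their minimal covers
    can be ordered by induction.  The covers avoiding [v] are listed first.  If
    [A] avoids [v] and [B] contains it, then [A] meets [f] in some [w] outside
    [B], and exchanging [v] for [w] in [B] gives a cover, since [v] is needed
    only for [f]; it has the size of [B], so by unmixedness it is minimal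
    ([free_vertex_exchange]).  It avoids [v], so it precedes [B].

    To stay on hypergraphs, the operations on ideals are translated: a polynomial
    is in an edge ideal exactly when the support of each of its monomials
    contains an edge ([edge_idealP]), from which colon ideals are contractions
    ([colon_edge_ideal]) and removed variables are deletions
    ([remove_variable_edge_ideal]).  These translations hold for arbitrary
    families of edges; inclusion-minimal edges are taken only to find a free
    vertex. *)

Set Implicit Arguments.
Unset Strict Implicit.
Unset Printing Implicit Defensive.

Import GRing.Theory.

(** * Membership in edge ideals *)

Definition edge_mnm (n : nat) (e : {set 'I_n}) : 'X_{1..n} :=
  (\sum_(i in e) U_(i))%MM.

Lemma edge_mnmE n (e : {set 'I_n}) i : edge_mnm e i = (i \in e).
Proof.
rewrite mnm_sumE; case: (boolP (i \in e)) => ie.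
  rewrite (bigD1 i) //= mnm1E eqxx big1 // => j /andP[_ ji].
  by rewrite mnm1E (negPf ji).
rewrite big1 // => j je; rewrite mnm1E; case: eqP => // ji.
by rewrite ji (negPf ie) in je.
Qed.

Lemma edge_mnm_le n (e : {set 'I_n}) (m : 'X_{1..n}) :
  (edge_mnm e <= m)%MM = (e \subset [set i | m i != 0%N]).
Proof.
apply/mnm_lepP/subsetP => [le i ie|sub i]; rewrite ?inE.
  by have := le i; rewrite edge_mnmE ie lt0n.
rewrite edge_mnmE; case: (boolP (i \in e)) => // /sub.
by rewrite inE lt0n.
Qed.

Lemma supp_edge_mnm n (e : {set 'I_n}) : [set i | edge_mnm e i != 0%N] = e.
Proof. by apply/setP => i; rewrite inE edge_mnmE eqb0 negbK. Qed.

Lemma edge_mnm1 n (i : 'I_n) : edge_mnm [set i] = U_(i)%MM.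
Proof. by rewrite /edge_mnm big_set1. Qed.

Lemma ideal_gen_ideal (R : comNzRingType) (G : set R) : ideal (ideal_gen G).
Proof.
split=> [I [[I0 _ _] _] //|a b Ia Ib I [idI GI]|a b Ib I [idI GI]].
  by case: (idI) => _ addI _; apply: addI; [apply: Ia | apply: Ib].
by case: (idI) => _ _ mulI; apply: mulI; apply: Ib.
Qed.

(** The polynomials satisfying the right-hand condition form an ideal containing
    the generators; conversely each term of such a polynomial is a multiple of a
    generator. *)
Lemma edge_idealP (K : fieldType) n (H : {set {set 'I_n}}) (p : {mpoly K[n]}) :
  edge_ideal K H p <->
  forall m, m \in msupp p ->
    exists2 e, e \in H & e \subset [set i | m i != 0%N].
Proof.
split=> [|suppH].
  pose J := [set q : {mpoly K[n]} | forall m, m \in msupp q ->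
    exists2 e, e \in H & e \subset [set i | m i != 0%N]%SET]%classic.
  move=> Ip; change (J p).
  apply: (Ip J); split; first split.
  - by move=> m; rewrite msupp0.
  - by move=> a b Ja Jb m /msuppD_le; rewrite mem_cat => /orP[/Ja|/Jb].
  - move=> a b Jb m /msuppM_le/allpairsP[[m1 m2] /= [_ /Jb[e eH sub] ->]].
    exists e => //; apply: subset_trans sub _; apply/subsetP => i.
    by rewrite !inE mnmDE addn_eq0 => /negPf->; rewrite andbF.
  - move=> _ [e eH ->] m; rewrite mprodXE msuppX inE => /eqP->.
    by exists e => //; rewrite (supp_edge_mnm e).
rewrite (mpolyE p) big_seq; have [I0 ID IM] := ideal_gen_ideal
  [set q : {mpoly K[n]} |
    exists2 e, e \in H & q = (\prod_(i in e) 'X_i)%R]%classic.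
elim/big_ind: _ => // m /suppH[e eH sub].
rewrite -edge_mnm_le in sub.
rewrite -(submK sub) mpolyXD -mul_mpolyC mulrA; apply: IM => J [_]; apply.
by exists e => //; rewrite mprodXE.
Qed.

Lemma edge_idealXP (K : fieldType) n (H : {set {set 'I_n}}) (m : 'X_{1..n}) :
  edge_ideal K H 'X_[m]%R <->
  exists2 e, e \in H & e \subset [set i | m i != 0%N].
Proof.
rewrite edge_idealP; split=> [|ex k]; first by apply; rewrite msuppX inE.
by rewrite msuppX inE => /eqP->.
Qed.

(** * Contractions, deletions and minimal edges *)

Definition contraction (T : finType) (S : {set T}) (H : {set {set T}}) :
    {set {set T}} :=
  [set e :\: S | e in H].

Definition deletion (T : finType) (v : T) (H : {set {set T}}) :
    {set {set T}} :=
  [set e in H | v \notin e].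

Definition min_edges (T : finType) (H : {set {set T}}) : {set {set T}} :=
  [set e | minset (fun f => f \in H) e].

Lemma contraction0 (T : finType) (H : {set {set T}}) : contraction set0 H = H.
Proof.
by rewrite /contraction (eq_imset _ (g := id)) ?imset_id // => e; rewrite setD0.
Qed.

Lemma contractionU1 (T : finType) x (S : {set T}) (H : {set {set T}}) :
  contraction [set x] (contraction S H) = contraction (x |: S) H.
Proof.
rewrite /contraction -imset_comp; apply: eq_imset => e /=.
by rewrite setUC -setDDl.
Qed.

Lemma contraction_set1 (T : finType) v f (H : {set {set T}}) :
  f \in H -> v \in f -> [set v] \in contraction (f :\ v) H.
Proof.
move=> fH vf; apply/imsetP; exists f => //.
by rewrite setDDr setDv set0U (setIidPr _) ?sub1set.
Qed.

Lemma min_edges_sub (T : finType) (H : {set {set T}}) : min_edges H \subset H.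
Proof. by apply/subsetP => e; rewrite inE => /minsetp. Qed.

Lemma min_edges_exists (T : finType) (H : {set {set T}}) e :
  e \in H -> exists2 f, f \in min_edges H & f \subset e.
Proof.
move=> /(@minset_exists _ (fun f => f \in H))[f mf fe].
by exists f; rewrite ?inE.
Qed.

Lemma min_edges_clutter (T : finType) (H : {set {set T}}) : clutter (min_edges H).
Proof.
move=> e f /(subsetP (min_edges_sub H)) eH; rewrite inE => mf ef.
exact: (minsetinf mf).
Qed.

(** Families of edges with the same minimal members have the same ideal; this
    lets contractions be formed without discarding redundant edges. *)
Lemma edge_ideal_min_edges (K : fieldType) n (H : {set {set 'I_n}}) :
  edge_ideal K (min_edges H) = edge_ideal K H.
Proof.
apply: funext => p; apply: propext; rewrite !edge_idealP; split=> suppH m /suppH[e].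
  by move=> /(subsetP (min_edges_sub H)) eH sub; exists e.
move=> /min_edges_exists[f fH fe] sub; exists f => //; exact: subset_trans sub.
Qed.

(** Multiplying by ['X_i] adds [i] to the support of every monomial, and an edge
    lies in the enlarged support exactly when it does so up to [i]. *)
Lemma colon_edge_ideal (K : fieldType) n (H : {set {set 'I_n}}) i :
  colon (edge_ideal K H) 'X_i%R = edge_ideal K (contraction [set i] H).
Proof.
apply: funext => p; apply: propext.
rewrite /colon /= (_ : edge_ideal K H _ <-> forall m, m \in msupp p ->
  exists2 e, e \in H & e \subset [set j | (U_(i) + m)%MM j != 0%N]); last first.
  rewrite edge_idealP; split=> suppH m.
    move=> mp; apply: suppH.
    by rewrite (perm_mem (msuppMX p U_(i)%MM)) map_f.
  by rewrite (perm_mem (msuppMX p U_(i)%MM)) => /mapP[k kp ->]; apply: suppH.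
have sub_shift (e : {set 'I_n}) m : (e \subset [set j | (U_(i) + m)%MM j != 0%N])
    = (e :\: [set i] \subset [set j | m j != 0%N]).
  rewrite subDset; suff ->: [set j | (U_(i) + m)%MM j != 0%N] =
    [set i] :|: [set j | m j != 0%N] by [].
  apply/setP => j.
  by rewrite !inE mnmDE mnm1E addn_eq0 negb_and eqb0 negbK (eq_sym j).
rewrite edge_idealP; split=> suppH m /suppH.
  case=> e eH; rewrite sub_shift => sub.
  by exists (e :\: [set i]) => //; apply: imset_f.
by case=> _ /imsetP[e eH ->]; rewrite -sub_shift; exists e.
Qed.

Lemma min_monomial_edge_ideal (K : fieldType) n (H : {set {set 'I_n}}) m :
  min_monomial (edge_ideal K H) m <->
  exists2 e, e \in min_edges H & m = edge_mnm e.
Proof.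
split=> [[/edge_idealXP[e eH sub] minm]|[e emin ->]].
  have [f fH fe] := min_edges_exists eH; exists f => //; apply/esym/minm.
    by rewrite edge_mnm_le (subset_trans fe).
  apply/edge_idealXP; exists f; rewrite ?supp_edge_mnm //.
  exact: (subsetP (min_edges_sub H)).
split.
  apply/edge_idealXP; exists e; rewrite ?supp_edge_mnm //.
  exact: (subsetP (min_edges_sub H)).
move=> k le /edge_idealXP[f fH fsub].
have fe : f = e.
  move: emin; rewrite inE => /minsetinf; apply=> //.
  apply: subset_trans fsub _; apply/subsetP => i; rewrite !inE -!lt0n => ki.
  by have := leq_trans ki (mnm_lepP le i); rewrite edge_mnmE; case: (i \in e).
apply/mnmP => i; apply/eqP; rewrite eqn_leq (mnm_lepP le) /=.
by move: fsub; rewrite fe -edge_mnm_le => /mnm_lepP.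
Qed.

(** As [[set i]] is an edge, it is the only minimal edge that can contain [i];
    so dropping the generator ['X_i] drops the variable altogether. *)
Lemma remove_variable_edge_ideal (K : fieldType) n (H : {set {set 'I_n}}) i :
  [set i] \in H ->
  remove_variable (edge_ideal K H) i = edge_ideal K (deletion i H).
Proof.
move=> iH; transitivity (edge_ideal K (deletion i (min_edges H))).
  rewrite /remove_variable /edge_ideal; congr ideal_gen.
  apply: funext => p; apply: propext; split.
    case=> m [/min_monomial_edge_ideal[e emin ->] neq ->].
    exists e; rewrite ?mprodXE // inE emin /=; apply: contra neq.
    move: emin; rewrite inE -sub1set => /minsetinf emin /(emin _ iH) <-.
    by rewrite edge_mnm1.
  case=> e; rewrite inE => /andP[emin ie] ->; exists (edge_mnm e).
  split; rewrite ?mprodXE //; first by apply/min_monomial_edge_ideal; exists e.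
  apply: contraNneq ie => em.
  by rewrite -sub1set -(supp_edge_mnm e) em -edge_mnm_le edge_mnm1 lepm_refl.
apply: funext => p; apply: propext; rewrite !edge_idealP.
split=> suppH m /suppH[e]; rewrite inE => /andP[eH ie] sub.
  by exists e; rewrite // inE ie (subsetP (min_edges_sub H)).
have [f fH fe] := min_edges_exists eH; exists f; last exact: subset_trans sub.
by rewrite inE fH (contra _ ie) //; apply: (subsetP fe).
Qed.

Lemma cminor_contraction (K : fieldType) n (I : set {mpoly K[n]}) S
    (H : {set {set 'I_n}}) :
  ideal_cminor I (edge_ideal K H) ->
  ideal_cminor I (edge_ideal K (contraction S H)).
Proof.
move=> IH; rewrite -(set_enum S); elim: (enum S) => [|x s IHs].
  by rewrite (_ : [set x in [::]] = set0) ?contraction0.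
rewrite set_cons -contractionU1 -colon_edge_ideal; exact: cminor_colon.
Qed.

Lemma cminor_deletion (K : fieldType) n (I : set {mpoly K[n]}) i
    (H : {set {set 'I_n}}) :
  ideal_cminor I (edge_ideal K H) -> [set i] \in H ->
  ideal_cminor I (edge_ideal K (deletion i H)).
Proof.
move=> IH iH; rewrite -remove_variable_edge_ideal //; apply: cminor_remove => //.
by apply/edge_idealXP; exists [set i] => //; rewrite -edge_mnm1 supp_edge_mnm.
Qed.

(** The c-minor given by [H] is the edge ideal of the clutter of minimal edges of
    [H]; it is nonzero because [H] has an edge, and proper because the empty set
    is not an edge. *)
Lemma free_vertex_of_cminor (K : fieldType) n (C H : {set {set 'I_n}}) :
  cminors_have_free_vertex K C -> ideal_cminor (edge_ideal K C) (edge_ideal K H) ->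
  H != set0 -> set0 \notin H -> exists v, free_vertex (min_edges H) v.
Proof.
move=> freeC CH /set0Pn[e eH] H0; apply: freeC.
- by split; [apply: min_edges_clutter | rewrite edge_ideal_min_edges].
- rewrite edge_ideal_min_edges => E.
  have: edge_ideal K H 'X_[edge_mnm e]%R.
    by apply/edge_idealXP; exists e; rewrite ?supp_edge_mnm.
  rewrite E /= => /(congr1 (mcoeff (edge_mnm e))) /eqP.
  by rewrite mcoeffX eqxx mcoeff0 oner_eq0.
rewrite edge_ideal_min_edges => E; have: edge_ideal K H 'X_[0%MM]%R by rewrite E.
case/edge_idealXP=> f fH; rewrite (_ : [set i | _] = set0) ?subset0.
  by move=> /eqP f0; rewrite f0 (negPf H0) in fH.
by apply/setP => i; rewrite !inE mnm0E eqxx.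
Qed.

(** * Minimal vertex covers of minors *)

Definition min_cover (T : finType) (H : {set {set T}}) : pred {set T} :=
  minset (vertex_cover H).

Lemma vertex_coverP (T : finType) (H : {set {set T}}) A :
  reflect {in H, forall e : {set T}, e :&: A != set0} (vertex_cover H A).
Proof. exact: forall_inP. Qed.

Lemma vertex_cover_min_edges (T : finType) (H : {set {set T}}) :
  vertex_cover (min_edges H) =1 vertex_cover H.
Proof.
move=> A; apply/vertex_coverP/vertex_coverP => covA e.
  move=> /min_edges_exists[f fH fe]; apply: contraNneq (covA f fH) => eA.
  by rewrite -subset0 -eA setSI.
by move/(subsetP (min_edges_sub H)); apply: covA.
Qed.

Lemma min_cover_min_edges (T : finType) (H : {set {set T}}) :
  min_cover (min_edges H) =1 min_cover H.
Proof. by move=> A; apply: minset_eq; apply: vertex_cover_min_edges. Qed.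

Lemma vertex_cover_contraction (T : finType) S (H : {set {set T}}) A :
  vertex_cover (contraction S H) A = vertex_cover H (A :\: S).
Proof.
have swap (e : {set T}) : (e :\: S) :&: A = e :&: (A :\: S).
  by rewrite setIDA setIC setIDA (setIC A).
apply/vertex_coverP/vertex_coverP => cov e.
  by move=> eH; rewrite -swap; apply/cov/imset_f.
by move=> /imsetP[f fH ->]; rewrite swap cov.
Qed.

(** A minimal cover of the contraction avoids [S], as no contracted edge meets
    [S]; on sets avoiding [S] the two notions of cover agree. *)
Lemma min_cover_contraction (T : finType) S (H : {set {set T}}) A :
  min_cover (contraction S H) A = min_cover H A && [disjoint A & S].
Proof.
apply/minsetP/andP; rewrite vertex_cover_contraction.
  case=> covA minA; have AS : A :\: S = A.
    by apply: minA; rewrite ?subsetDl // vertex_cover_contraction setDDl setUid.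
  split; last exact/setDidPl.
  apply/minsetP; split=> [|B covB BA]; first by rewrite -AS.
  apply: minA => //; rewrite vertex_cover_contraction.
  by rewrite (setDidPl _) // (disjointWl BA) //; apply/setDidPl.
case=> /minsetP[covA minA] dAS; split; first by rewrite (setDidPl dAS).
move=> B; rewrite vertex_cover_contraction => covB BA.
by apply: minA => //; rewrite (setDidPl (disjointWl BA dAS)) in covB.
Qed.

Lemma vertex_cover_deletion (T : finType) v (H : {set {set T}}) A :
  [set v] \in H ->
  vertex_cover H (v |: A) = vertex_cover (deletion v H) A.
Proof.
have disj (e : {set T}) : v \notin e -> e :&: (v |: A) = e :&: A.
  move=> ve; rewrite setIUr (_ : e :&: [set v] = set0) ?set0U //.
  by apply/eqP; rewrite setI_eq0 disjoint_sym disjoints1.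
move=> vH; apply/vertex_coverP/vertex_coverP => cov e.
  by rewrite inE => /andP[eH ve]; rewrite -disj // cov.
case: (boolP (v \in e)) => ve eH; last by rewrite disj // cov // inE eH.
by apply/set0Pn; exists v; rewrite !inE ve eqxx.
Qed.

Lemma min_cover_deletion (T : finType) v (H : {set {set T}}) A :
  [set v] \in H ->
  min_cover (deletion v H) A = (v \notin A) && min_cover H (v |: A).
Proof.
move=> vH; have inv B : vertex_cover H B -> v \in B.
  move=> /vertex_coverP/(_ _ vH); apply: contraNT => vB.
  by rewrite setI_eq0 disjoints1.
apply/minsetP/andP.
  case=> covA minA.
  have vA : v \notin A.
    rewrite -(minA (A :\ v)) ?subsetDl ?setD11 // -vertex_cover_deletion //.
    rewrite (_ : v |: A :\ v = v |: A) ?vertex_cover_deletion //.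
    by apply/setP => x; rewrite !inE; case: eqP.
  split=> //; apply/minsetP; rewrite vertex_cover_deletion //; split=> // B covB BA.
  have vB := inv B covB; rewrite -(setD1K vB) (minA (B :\ v)) ?subDset //.
  by rewrite -vertex_cover_deletion // setD1K.
case=> vA /minsetP[covA minA]; rewrite -vertex_cover_deletion //; split=> // B covB BA.
have vB : v \notin B by apply: contra vA => /(subsetP BA).
rewrite -(setU1K vB) (minA (v |: B)) ?setU1K ?vertex_cover_deletion //.
exact: setUS.
Qed.

(** * Shelling orders on minimal covers *)

(** The shelling condition, read on complements of facets. *)
Definition exchange_order (T : finType) (s : seq {set T}) : Prop :=
  forall i j, i < j < size s ->
  exists v l, [/\ v \in nth set0 s i :\: nth set0 s j, l < j
    & nth set0 s l :\: nth set0 s j = [set v]].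

Definition cover_shelling (T : finType) (H : {set {set T}}) (s : seq {set T}) :
    Prop :=
  [/\ uniq s, forall A, (A \in s) = min_cover H A & exchange_order s].

Lemma exchange_order_cat (T : finType) (s t : seq {set T}) :
  exchange_order s -> exchange_order t ->
  (forall A B, A \in s -> B \in t ->
     exists2 v, v \in A :\: B & exists2 A', A' \in s & A' :\: B = [set v]) ->
  exchange_order (s ++ t).
Proof.
move=> exs ext cross i j /andP[ij]; rewrite size_cat => jst.
case: (ltnP j (size s)) => js.
  have is_ := ltn_trans ij js; have [|v [l [vi lj lv]]] := exs i j; first by rewrite ij.
  by exists v, l; rewrite !nth_cat is_ js (ltn_trans lj js).
have jt : j - size s < size t by rewrite ltn_subLR.
have nj : nth set0 (s ++ t) j = nth set0 t (j - size s) by rewrite nth_cat ltnNge js.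
case: (ltnP i (size s)) => is_.
  have [v vi [A' A's A'v]] := cross _ _ (mem_nth set0 is_) (mem_nth set0 jt).
  exists v, (index A' s); rewrite nj !nth_cat is_ index_mem A's nth_index //.
  by split=> //; apply: leq_trans js; rewrite index_mem.
have [|v [l [vi lj lv]]] := ext (i - size s) (j - size s).
  by rewrite jt ltn_sub2r // (leq_ltn_trans is_).
have nl : nth set0 (s ++ t) (size s + l) = nth set0 t l.
  by rewrite nth_cat ltnNge leq_addr addKn.
exists v, (size s + l); rewrite nj nl nth_cat ltnNge is_.
by split=> //; rewrite -ltn_subRL.
Qed.

Lemma exchange_order_setU1 (T : finType) v (s : seq {set T}) :
  {in s, forall A : {set T}, v \notin A} -> exchange_order s ->
  exchange_order [seq v |: A | A <- s].
Proof.
move=> vs exs i j; rewrite size_map => /andP[ij js].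
have dropv A B : A \in s -> (v |: A) :\: (v |: B) = A :\: B.
  move=> /vs vA; apply/setP => x; rewrite !inE negb_or.
  by case: eqP => //= ->; rewrite (negPf vA) andbF.
have [|w [l [wi lj lw]]] := exs i j; first by rewrite ij.
have [is_ ls] := (ltn_trans ij js, ltn_trans lj js).
by exists w, l; rewrite !(nth_map set0) // !dropv ?mem_nth.
Qed.

(** By minimality [B :\ v] misses some edge; that edge contains [v], hence it is
    [f]. *)
Lemma free_vertex_cover (T : finType) (H : {set {set T}}) v f B :
  {in H, forall e : {set T}, v \in e -> e = f} -> min_cover H B -> v \in B ->
  [disjoint B & f :\ v].
Proof.
move=> freev /minsetP[/vertex_coverP covB minB] vB.
have : ~~ vertex_cover H (B :\ v).
  by apply/negP => /minB/(_ (subsetDl _ _)) BE; move: vB; rewrite -BE setD11.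
case/forall_inPn=> e eH; rewrite negbK => /eqP eBv.
suff ef : e = f by rewrite -setI_eq0 -ef setIDA (setIC B) -setIDA eBv.
apply: freev => //; have /set0Pn[x] := covB e eH; rewrite inE => /andP[xe xB].
case: (x =P v) => [<- //|/eqP xv].
by have : x \in e :&: (B :\ v) by [rewrite !inE xe xv]; rewrite eBv inE.
Qed.

(** The set [A'] is [B] with [v] exchanged for a vertex [w] of [A] on [f]. The
    edge [f] is the only one that loses [v], and [w] meets it; unmixedness then
    turns the size of [A'] into minimality. *)
Lemma free_vertex_exchange (T : finType) (H : {set {set T}}) v f A B :
  unmixed H -> {in H, forall e : {set T}, v \in e -> e = f} -> f \in H ->
  min_cover H A -> v \notin A -> min_cover H B -> v \in B ->
  exists2 w, w \in A :\: B & exists2 A', min_cover H A' && (v \notin A') &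
    A' :\: B = [set w].
Proof.
move=> unmixH freev fH minA vA minB vB.
have dBf := free_vertex_cover freev minB vB.
have /vertex_coverP covA := minsetp minA.
have /vertex_coverP covB := minsetp minB.
have /set0Pn[w] := covA f fH; rewrite inE => /andP[wf wA].
have wv : w != v by apply: contraNneq vA => <-.
have wB : w \notin B.
  by apply: contraL wf => wB; have := disjointFr dBf wB; rewrite !inE wv => /= ->.
exists w; first by rewrite inE wB.
pose A' := w |: B :\ v.
have covA' : vertex_cover H A'.
  apply/vertex_coverP => e eH; apply/set0Pn; case: (boolP (v \in e)) => ve.
    by exists w; rewrite (freev e) // !inE wf eqxx.
  have /set0Pn[x] := covB e eH; rewrite inE => /andP[xe xB]; exists x.
  rewrite !inE xe xB andbT; apply/orP; right; apply: contraNneq ve => <- //.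
have cardA' : #|A'| = #|B|.
  by rewrite cardsU1 !inE negb_and wB orbT (cardsD1 v B) vB.
exists A'; last first.
  apply/setP => x; rewrite !inE; case: (x =P w) => [->|_] /=; first by rewrite wB.
  by case: (x \in B); rewrite ?andbF.
have -> : v \notin A' by rewrite !inE eqxx orbF eq_sym.
rewrite andbT; have [A'' minA'' sA''] := minset_exists covA'.
suff -> : A' = A'' by exact: minA''.
by apply/esym/eqP; rewrite eqEcard sA'' cardA' (unmixH _ _ minA'' minB) leqnn.
Qed.

(** * The induction along a free vertex *)

Lemma unmixed_contraction (T : finType) S (H : {set {set T}}) :
  unmixed H -> unmixed (contraction S H).
Proof.
have minH A : min_cover (contraction S H) A -> min_cover H A.
  by rewrite min_cover_contraction => /andP[].
by move=> unmixH A B /minH minA /minH; apply: unmixH.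
Qed.

Lemma unmixed_deletion (T : finType) v (H : {set {set T}}) :
  [set v] \in H -> unmixed H -> unmixed (deletion v H).
Proof.
move=> vH unmixH A B.
have minH F : min_cover (deletion v H) F -> v \notin F /\ min_cover H (v |: F).
  by rewrite min_cover_deletion // => /andP.
move=> /minH[vA minA] /minH[vB minB]; have := unmixH _ _ minA minB.
by rewrite !cardsU1 vA vB => /addnI.
Qed.

(** The covers containing [v] come last: by [free_vertex_exchange] each of them
    is one exchange away from a cover avoiding [v]. *)
Lemma cover_shelling_free_vertex (T : finType) (H : {set {set T}}) v f s t :
  unmixed H -> {in H, forall e : {set T}, v \in e -> e = f} -> f \in H -> v \in f ->
  cover_shelling (contraction [set v] H) s ->
  cover_shelling (deletion v (contraction (f :\ v) H)) t ->
  cover_shelling H (s ++ [seq v |: A | A <- t]).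
Proof.
move=> unmixH freev fH vf [uniqs mems exs] [uniqt memt ext].
have vG := contraction_set1 fH vf.
have sE A : (A \in s) = min_cover H A && (v \notin A).
  by rewrite mems min_cover_contraction disjoint_sym disjoints1.
have tE A : (A \in t) = (v \notin A) && min_cover H (v |: A).
  rewrite memt min_cover_deletion // min_cover_contraction.
  case: (boolP (min_cover H _)) => minA; rewrite ?andbF //=.
  by rewrite (free_vertex_cover freev minA) // setU11.
have uE B : (B \in [seq v |: A | A <- t]) = min_cover H B && (v \in B).
  apply/mapP/andP => [[A + ->]|[minB vB]].
    by rewrite tE => /andP[vA minA]; rewrite minA setU11.
  by exists (B :\ v); rewrite ?tE setD1K // setD11.
split.
- rewrite cat_uniq uniqs map_inj_in_uniq ?uniqt ?andbT /=.
    by apply/hasPn => B; rewrite uE sE => /andP[_ ->]; rewrite andbF.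
  move=> A B; rewrite !tE => /andP[vA _] /andP[vB _] eqAB.
  by rewrite -(setU1K vA) eqAB setU1K.
- by move=> A; rewrite mem_cat sE uE -andb_orr orNb andbT.
apply: exchange_order_cat => //.
  by apply: exchange_order_setU1 => // A; rewrite tE => /andP[].
move=> A B; rewrite sE uE => /andP[minA vA] /andP[minB vB].
have [w wAB [A' sA' A'B]] := free_vertex_exchange unmixH freev fH minA vA minB vB.
by exists w => //; exists A'; rewrite ?sE.
Qed.

Lemma card_cover_avoid (T : finType) v (H G : {set {set T}}) :
  v \in cover H -> {in G, forall e : {set T}, v \notin e} ->
  cover G \subset cover H -> #|cover G| < #|cover H|.
Proof.
move=> vH vG sub; apply: proper_card; apply/properP; split=> //.
by exists v => //; apply/bigcupP => -[e /vG/negP].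
Qed.

Lemma cover_contraction (T : finType) S (H : {set {set T}}) :
  cover (contraction S H) \subset cover H.
Proof.
apply/bigcupsP => _ /imsetP[e eH ->].
exact: subset_trans (subsetDl _ _) (bigcup_sup e eH).
Qed.

(** Induction over all c-minors [H] of a fixed [C], so that the hypothesis on free
    vertices stays the same throughout. *)
Lemma cover_shellable (K : fieldType) n (C H : {set {set 'I_n}}) :
  cminors_have_free_vertex K C -> ideal_cminor (edge_ideal K C) (edge_ideal K H) ->
  unmixed H -> exists s, cover_shelling H s.
Proof.
move=> freeC; have [m] := ubnP #|cover H|; elim: m H => // m IH H.
rewrite ltnS => lem CH unmixH.
(* The empty edge cannot be met, so there are no covers. *)
have [H0|H0] := boolP (set0 \in H).
  exists [::]; split=> // [A|i j]; last by rewrite ltn0 andbF.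
  rewrite in_nil; apply/esym/negP => /minsetp.
  by move=> /vertex_coverP/(_ _ H0); rewrite set0I eqxx.
have [->|Hn0] := eqVneq H set0.
  exists [:: set0]; split=> // [A|i j /andP[ij]]; last first.
    by rewrite ltnS leqn0 => /eqP j0; rewrite j0 in ij.
  rewrite inE; apply/eqP/minsetP => [->|[_ minA]].
    by split=> [|B _]; [apply/vertex_coverP => e; rewrite inE | rewrite subset0 => /eqP].
  by rewrite (minA set0) ?sub0set //; apply/vertex_coverP => e; rewrite inE.
have [v /eqP/cards1P[f Ef]] := free_vertex_of_cminor freeC CH Hn0 H0.
set D := min_edges H in Ef.
have /andP[fD vf] : (f \in D) && (v \in f).
  by have : f \in [set f] := set11 f; rewrite -Ef inE.
have freev : {in D, forall e : {set 'I_n}, v \in e -> e = f}.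
  by move=> e eD ve; apply/set1P; rewrite -Ef inE eD.
have CD : ideal_cminor (edge_ideal K C) (edge_ideal K D).
  by rewrite edge_ideal_min_edges.
have minDE A : min_cover D A -> min_cover H A by rewrite min_cover_min_edges.
have unmixD : unmixed D by move=> A B /minDE minA /minDE; apply: unmixH.
have coverD : cover D \subset cover H.
  by apply/bigcupsP => e /(subsetP (min_edges_sub H)) eH; apply: bigcup_sup.
have vH : v \in cover H.
  by apply: (subsetP coverD); apply/bigcupP; exists f.
have vG := contraction_set1 fD vf.
have [||s shs] := IH (contraction [set v] D) _ (cminor_contraction _ CD).
- apply: leq_trans lem; apply: card_cover_avoid vH _ _.
    by move=> _ /imsetP[e _ ->]; rewrite setD11.
  exact: subset_trans (cover_contraction _ _) coverD.
- exact: unmixed_contraction.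
have [||t sht] := IH (deletion v (contraction (f :\ v) D)) _
  (cminor_deletion (cminor_contraction _ CD) vG).
- apply: leq_trans lem; apply: card_cover_avoid vH _ _.
    by move=> e; rewrite inE => /andP[].
  apply: subset_trans (subset_trans (cover_contraction (f :\ v) D) coverD).
  by apply/bigcupsP => e; rewrite inE => /andP[eG _]; apply: bigcup_sup.
- exact/unmixed_deletion/unmixed_contraction.
have [us ms es] := cover_shelling_free_vertex unmixD freev fD vf shs sht.
exists (s ++ [seq v |: A | A <- t]); split=> // A.
by rewrite ms; apply: min_cover_min_edges.
Qed.

(** * Facets as complements of minimal covers *)

Lemma facets_independence_complex (T : finType) (C : {set {set T}}) F :
  (F \in facets (independence_complex C)) = min_cover C (~: F).
Proof.
rewrite inE maxminset; apply: minset_eq => A /=; rewrite inE.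
by apply: eq_forallb_in => e _; rewrite -disjoints_subset setI_eq0.
Qed.

Theorem theorem2p8 (K : fieldType) (n : nat) (C : {set {set 'I_n}})
    (g : nat) (e : 'I_g -> {set 'I_n}) :
  clutter C ->
  konig_perfect_matching K C e ->
  cminors_have_free_vertex K C ->
  unmixed C ->
  pure (independence_complex C) /\ shellable (independence_complex C).
Proof.
move=> _ _ freeC unmixC; split=> [F G|].
  rewrite !facets_independence_complex => minF minG.
  apply: (@addnI #|~: F|); rewrite addnC cardsC (unmixC _ _ minF minG).
  by rewrite addnC cardsC.
have [s [us ms exs]] := cover_shellable freeC (cminor_refl _) unmixC.
exists [seq ~: A | A <- s]; split=> [|F|i j].
- by rewrite map_inj_uniq //; apply: setC_inj.
- rewrite facets_independence_complex -[F]setCK mem_map ?ms ?setCK //.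
  exact: setC_inj.
rewrite size_map => /andP[ij js].
have diffC (A B : {set 'I_n}) : ~: B :\: ~: A = A :\: B.
  by rewrite !setDE setCK setIC.
have [|v [l [vi lj lv]]] := exs i j; first by rewrite ij.
have [is_ ls] := (ltn_trans ij js, ltn_trans lj js).
by exists v, l; rewrite !(nth_map set0) // !diffC.
Qed.
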